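(* Let $\mu$ be a monotone system with support $\Omega\subseteq\{0,1\}^V$, $|V|=n$, and let $\theta\in(0,1)$. Then for every $\epsilon\in(0,1)$, \[ T^{\mathrm{GD}}_{\mathrm{mix}\text{-}\mathbf 1_V}(\mu,\epsilon)\le T^{\mathrm{FD}}_{\mathrm{mix}}\left(\mu,\theta,\tfrac\epsilon2\right)\cdot T^{\mathrm{tilted}}_{\mathrm{mix}}(\mu,\theta,\delta),\qquad\text{where }\delta=\frac{\epsilon}{2T^{\mathrm{FD}}_{\mathrm{mix}}(\mu,\theta,\frac\epsilon2)}. \]
   Context: Partial order on $\{0,1\}^S$: $X\preceq Y$ iff $X_v\le Y_v$ for all $v$. For a feasible (positive-probability) pinning $\sigma$ on $S\subseteq V$, $\mu^\sigma$ is $\mu$ conditioned on $\sigma$ and $\mu^\sigma_v$ its marginal at $v$; $\mu_\Lambda$ is the marginal on $\Lambda$. Monotone system: for every $v$ and all feasible $\sigma\preceq\tau$ in $\{0,1\}^{V\setminus\{v\}}$, $\mu^\sigma_v(1)\le\mu^\tau_v(1)$. Tilted distribution: $(\theta*\mu)(\sigma)\propto\mu(\sigma)\theta^{\|\sigma\|_1}$ on $\Omega$. Glauber dynamics $P$ on $\nu$: pick $v$ uniformly, resample $X_v\sim\nu_v^{X_{V\setminus\{v\}}}$. $T^{\mathrm{GD}}_{\mathrm{mix}\text{-}X_0}(\nu,\epsilon)=\min\{t:d_{\mathrm{TV}}(P^t(X_0,\cdot),\nu)\le\epsilon\}$; $T^{\mathrm{GD}}_{\mathrm{mix}}(\nu,\epsilon)$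 is the maximum of this over all feasible $X_0$. $T^{\mathrm{tilted}}_{\mathrm{mix}}(\mu,\theta,\epsilon)=\max\{T^{\mathrm{GD}}_{\mathrm{mix}}((\theta*\mu)^{\mathbf 1_\Lambda},\epsilon):\Lambda\subseteq V,\mu_\Lambda(\mathbf 1_\Lambda)>0\}$. Field dynamics $P_{\theta,\mu}$: from $X\in\Omega$, build a random $S\subseteq V$ including each $v$ independently with probability $\theta$ if $X_v=1$ and $1$ if $X_v=0$; then resample $X\sim(\theta*\mu)^{\mathbf 1_{V\setminus S}}$. $T^{\mathrm{FD}}_{\mathrm{mix}}(\mu,\theta,\epsilon)=\max_{X\in\Omega}\min\{t:d_{\mathrm{TV}}(P^t_{\theta,\mu}(X,\cdot),\mu)\le\epsilon\}$. *)

(* Defs.v *)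
From HB Require Import structures.
From mathcomp Require Import all_boot all_order all_algebra.
From mathcomp Require Import boolp.
Set Implicit Arguments. Unset Strict Implicit. Unset Printing Implicit Defensive.
Import Order.TTheory GRing.Theory Num.Theory.
Local Open Scope ring_scope.

Notation config V := {ffun V -> bool}.

Section Defs.
Variables (R : realFieldType) (V : finType).

Definition ones : config V := [ffun _ => true].

Definition is_dist (mu : config V -> R) : Prop :=
  (forall x, 0 <= mu x) /\ \sum_x mu x = 1.

Definition agree (A : {set V}) (sigma x : config V) : bool :=
  [forall v in A, x v == sigma v].

(* mu(sigma_A) : probability of the pinning sigma on A; the pinning is
   feasible iff this is positive.  Also the marginal mu_A(sigma_A). *)
Definition pin_mass (mu : config V -> R) (A : {set V}) (sigma : config V) : R :=
  \sum_(x | agree A sigma x) mu x.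

Definition cond (mu : config V -> R) (A : {set V}) (sigma : config V)
  : config V -> R :=
  fun x => if agree A sigma x then mu x / pin_mass mu A sigma else 0.

Definition marg1 (mu : config V -> R) (A : {set V}) (sigma : config V) (v : V) : R :=
  \sum_(x : config V | x v) cond mu A sigma x.

(* monotone system: for all v and feasible pinnings sigma <= tau on V\{v},
   mu^sigma_v(1) <= mu^tau_v(1). A pinning on V\{v} is given by a full
   configuration whose value at v is ignored. *)
Definition monotone_system (mu : config V -> R) : Prop :=
  forall (v : V) (sigma tau : config V),
    0 < pin_mass mu (~: [set v]) sigma ->
    0 < pin_mass mu (~: [set v]) tau ->
    (forall u, u != v -> sigma u ==> tau u) ->
    marg1 mu (~: [set v]) sigma v <= marg1 mu (~: [set v]) tau v.

Definition ones_count (x : config V) : nat := #|[set v | x v]|.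
Definition tilt (mu : config V -> R) (theta : R) : config V -> R :=
  fun x => mu x * theta ^+ ones_count x /
           \sum_y mu y * theta ^+ ones_count y.

Definition step (P : config V -> config V -> R) (d : config V -> R)
  : config V -> R := fun y => \sum_x d x * P x y.
Definition dirac (x0 : config V) : config V -> R :=
  fun x => if x == x0 then 1 else 0.
Definition dist_after (P : config V -> config V -> R) (X0 : config V) (t : nat)
  : config V -> R := iter t (step P) (dirac X0).

Definition dTV (d1 d2 : config V -> R) : R :=
  2^-1 * \sum_x `|d1 x - d2 x|.

(* Glauber dynamics on nu: pick v uniformly, resample X_v from
   nu_v^{X_{V \ {v}}}.  cond nu (V\{v}) X Y is zero unless Y agrees with X
   off v, in which case it equals nu_v^{X_{V\{v}}}(Y_v). *)
Definition glauber (nu : config V -> R) : config V -> config V -> R :=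
  fun X Y => (#|V|%:R)^-1 * \sum_v cond nu (~: [set v]) X Y.

Definition fd_sel_prob (theta : R) (X : config V) (S : {set V}) : R :=
  \prod_v (if X v then (if v \in S then theta else 1 - theta)
           else (if v \in S then 1 else 0)).
Definition field_dynamics (mu : config V -> R) (theta : R)
  : config V -> config V -> R :=
  fun X Y => \sum_(S : {set V}) fd_sel_prob theta X S *
                                 cond (tilt mu theta) (~: S) ones Y.

End Defs.

(* least t satisfying P (None if there is none, i.e. "infinity") *)
Definition first_time (P : nat -> Prop) : option nat :=
  match pselect (exists n, `[< P n >]) with
  | left h => Some (@ex_minn (fun n => `[< P n >]) h)
  | right _ => None
  end.

Definition omax (T : finType) (A : pred T) (f : T -> option nat) : option nat :=
  if [forall x, A x ==> (f x != None)]
  then Some (\max_(x | A x) odflt 0%N (f x)) else None.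

Section Mix.
Variables (R : realFieldType) (V : finType).

Definition Tmix_from (P : config V -> config V -> R) (nu : config V -> R)
  (X0 : config V) (eps : R) : option nat :=
  first_time (fun t => dTV (dist_after P X0 t) nu <= eps).

Definition TGD_from (nu : config V -> R) (X0 : config V) (eps : R) : option nat :=
  Tmix_from (glauber nu) nu X0 eps.

Definition TGD (nu : config V -> R) (eps : R) : option nat :=
  omax (fun X0 => 0 < nu X0) (fun X0 => TGD_from nu X0 eps).

Definition Ttilted (mu : config V -> R) (theta eps : R) : option nat :=
  omax (fun L : {set V} => 0 < pin_mass mu L (ones V))
       (fun L => TGD (cond (tilt mu theta) L (ones V)) eps).

Definition TFD (mu : config V -> R) (theta eps : R) : option nat :=
  omax (fun X => 0 < mu X)
       (fun X => Tmix_from (field_dynamics mu theta) mu X eps).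

End Mix.

(* Main.v *)
Require Import Defs.
From HB Require Import structures.
From mathcomp Require Import all_boot all_order all_algebra.
From mathcomp Require Import boolp ring lra.
Import Order.TTheory GRing.Theory Num.Theory.
Set Implicit Arguments. Unset Strict Implicit. Unset Printing Implicit Defensive.
Local Open Scope ring_scope.

(* Split the state 1 of each site into 1 (weight theta) and 2 (weight
   1 - theta). The field dynamics refreshes the set L of sites in state 2 and
   then resamples the other sites; replace this resampling by T2 steps of
   Glauber dynamics on the tilted distribution given L. Each such step is a
   heat bath on {0, 1} with the state 2 frozen, whereas a step of the Glauber
   dynamics on mu is a heat bath on {0, 1, 2}, followed by forgetting which
   ones are in state 2. Every kernel involved is monotone for 0 < 1 < 2, so for
   increasing f and e the correlation of f with the iterates of e under the
   full heat bath is at most the one obtained with the frozen heat baths, as in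
   the censoring inequality. Since the density with respect to mu of the Glauber
   dynamics started at the all-ones configuration is increasing, the total
   variation distance to mu is attained on an increasing event, and for this
   event the comparison process dominates. Finally, T1 rounds of the comparison
   process differ from T1 steps of the field dynamics by at most
   T1 * delta <= eps / 2. *)

(** * Kernels and mixing times *)

Section Operators.
Variables (R : realFieldType) (V : finType).
Implicit Types (P : config V -> config V -> R) (d nu h : config V -> R).

(** The action on observables, dual to [step]; laws are only ever tested against functions. *)
Definition op P h : config V -> R := fun x => \sum_y P x y * h y.

Lemma step_op P d h : \sum_y step P d y * h y = \sum_x d x * op P h x.
Proof.
under eq_bigr => y _ do rewrite /step mulr_suml.
rewrite exchange_big /=; apply: eq_bigr => x _; rewrite /op mulr_sumr.
by apply: eq_bigr => y _; rewrite mulrA.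
Qed.

Lemma sum_dirac (x : config V) h : \sum_y dirac R x y * h y = h x.
Proof.
rewrite (bigD1 x) //= /dirac eqxx mul1r big1 ?addr0 // => y /negPf ->.
by rewrite mul0r.
Qed.

Lemma dist_after_op P x t h :
  \sum_y dist_after P x t y * h y = iter t (op P) h x.
Proof.
elim: t h => [|t IH] h; first exact: sum_dirac.
by rewrite /dist_after iterS step_op IH -iterSr.
Qed.

(** Stationarity writes the difference of the new laws as the old difference pushed through [P]. Row
    sums at most 1 are the right assumption for [glauber]: [cond] vanishes identically on an
    infeasible pinning, so some rows have sum below 1. *)
Lemma step_substochastic_dTV P d nu :
  (forall x y, 0 <= P x y) -> (forall x, \sum_y P x y <= 1) ->
  step P nu =1 nu -> dTV (step P d) nu <= dTV d nu.
Proof.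
move=> P0 P1 st; rewrite /dTV ler_wpM2l ?invr_ge0 ?ler0n //.
apply: (@le_trans _ _ (\sum_y \sum_x `|d x - nu x| * P x y)).
  apply: ler_sum => y _; rewrite -{1}(st y) /step -sumrB.
  apply: le_trans (ler_norm_sum _ _ _) _.
  by apply: ler_sum => x _; rewrite -mulrBl normrM (ger0_norm (P0 _ _)).
rewrite exchange_big /=; apply: ler_sum => x _.
by rewrite -mulr_sumr -[leRHS]mulr1 ler_wpM2l.
Qed.

(** Lets the first mixing time from one start be replaced by the maximum over all starts. *)
Lemma dTV_dist_after_le P x nu s t :
  (forall x y, 0 <= P x y) -> (forall x, \sum_y P x y <= 1) ->
  step P nu =1 nu -> (s <= t)%N ->
  dTV (dist_after P x t) nu <= dTV (dist_after P x s) nu.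
Proof.
move=> P0 P1 st /subnK <-; elim: (t - s)%N => [//|k IH].
by rewrite addSn; apply: le_trans (step_substochastic_dTV _ _ _ _) IH.
Qed.

Lemma expectation_dTV d1 d2 h :
  \sum_x d1 x = \sum_x d2 x -> (forall x, 0 <= h x <= 1) ->
  `|\sum_x d1 x * h x - \sum_x d2 x * h x| <= dTV d1 d2.
Proof.
move=> e h01.
(* subtracting the constant 1/2 from h makes it bounded by 1/2 in absolute value *)
have -> : \sum_x d1 x * h x - \sum_x d2 x * h x
        = \sum_x (d1 x - d2 x) * (h x - 2^-1).
  under [RHS]eq_bigr => x _ do rewrite mulrBr mulrBl.
  rewrite sumrB sumrB -mulr_suml sumrB e subrr mul0r subr0 //.
apply: le_trans (ler_norm_sum _ _ _) _.
rewrite /dTV mulr_sumr; apply: ler_sum => x _.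
rewrite normrM mulrC ler_wpM2r // ler_norml; move: (h01 x); lra.
Qed.

(** Pointwise, half of the absolute difference minus the positive part of [d1 - d2] is
    [(d2 - d1) / 2], which sums to 0. *)
Lemma dTV_upper_set d1 d2 :
  \sum_x d1 x = \sum_x d2 x ->
  dTV d1 d2 = \sum_x d1 x * (d2 x < d1 x)%R%:R - \sum_x d2 x * (d2 x < d1 x)%R%:R.
Proof.
move=> e; rewrite -sumrB /dTV mulr_sumr.
apply/eqP; rewrite -subr_eq0 -sumrB.
have -> : \sum_x (2^-1 * `|d1 x - d2 x| -
   (d1 x * (d2 x < d1 x)%R%:R - d2 x * (d2 x < d1 x)%R%:R))
   = \sum_x (d2 x - d1 x) * 2^-1.
  apply: eq_bigr => x _; case: ltP => h.
    rewrite gtr0_norm ?subr_gt0 // !mulr1; lra.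
  rewrite ler0_norm ?subr_le0 // !mulr0; lra.
by rewrite -mulr_suml sumrB e subrr mul0r.
Qed.

End Operators.

(** * First hitting times and their maxima *)

Section MixingTimes.

Lemma first_time_Some (Q : nat -> Prop) t : first_time Q = Some t -> Q t.
Proof.
rewrite /first_time; case: pselect => // ex [<-].
by case: ex_minnP => m /asboolP.
Qed.

Lemma first_time_le (Q : nat -> Prop) t :
  Q t -> exists s, first_time Q = Some s /\ (s <= t)%N.
Proof.
move=> Qt; rewrite /first_time; case: pselect => [ex|[]]; last first.
  by exists t; apply/asboolP.
exists (ex_minn ex); split=> //; case: ex_minnP => m _; apply; exact/asboolP.
Qed.

Lemma omax_Some (T : finType) (A : pred T) (f : T -> option nat) t x :
  omax A f = Some t -> A x -> exists s, f x = Some s /\ (s <= t)%N.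
Proof.
rewrite /omax; case: ifP => // /forallP /(_ x) + [<-] Ax.
rewrite Ax /=; case E : (f x) => [s|] // _; exists s; split=> //.
have -> : s = odflt 0%N (f x) by rewrite E.
exact: (@leq_bigmax_cond _ A (fun y => odflt 0%N (f y)) x).
Qed.

End MixingTimes.

(** * Single-site heat baths and Glauber dynamics *)

Section HeatBath.
Variables (R : realFieldType) (V : finType).
Implicit Types (nu h : config V -> R) (x y : config V) (v : V) (A L : {set V}).

Definition up v x : config V := [ffun u => (u == v) || x u].
Definition dn v x : config V := [ffun u => (u != v) && x u].

Lemma up_id v x : x v -> up v x = x.
Proof. by move=> xv; apply/ffunP=> u; rewrite ffunE; case: eqP => // ->. Qed.

Lemma dn_id v x : ~~ x v -> dn v x = x.
Proof.
move=> /negPf xv; apply/ffunP=> u; rewrite ffunE; case: eqP => //= ->.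
by rewrite xv.
Qed.

Lemma up_dn v x : up v (dn v x) = up v x.
Proof. by apply/ffunP=> u; rewrite !ffunE; case: eqP. Qed.

Lemma dn_up v x : dn v (up v x) = dn v x.
Proof. by apply/ffunP=> u; rewrite !ffunE; case: eqP. Qed.

Lemma up_at v x : up v x v. Proof. by rewrite ffunE eqxx. Qed.
Lemma dn_at v x : dn v x v = false. Proof. by rewrite ffunE eqxx. Qed.

Lemma up_neq_dn v x : up v x != dn v x.
Proof. by apply/eqP=> /ffunP /(_ v); rewrite up_at dn_at. Qed.

Lemma up_or_dn v x : x = up v x \/ x = dn v x.
Proof.
by case xv : (x v); [left; rewrite up_id | right; rewrite dn_id ?xv].
Qed.

Lemma agreeP A x y : reflect {in A, y =1 x} (agree A x y).
Proof.
by apply: (iffP forallP) => h u; [move=> uA; have := h u; rewrite uA => /eqP |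
  apply/implyP => uA; rewrite h].
Qed.

Lemma agree_sym A x y : agree A x y = agree A y x.
Proof. by apply/agreeP/agreeP => h u uA; rewrite h. Qed.

Lemma agree_trans A x y z : agree A x y -> agree A x z = agree A y z.
Proof.
move=> /agreeP h; apply/agreeP/agreeP => h' u uA; rewrite h' //; last by rewrite h.
by rewrite h.
Qed.

Lemma agree_setC1 v x y :
  agree (~: [set v]) x y = (y == up v x) || (y == dn v x).
Proof.
apply/agreeP/orP => [h|[]/eqP-> u]; last first.
- by rewrite !inE ffunE => ->.
- by rewrite !inE ffunE => /negPf ->.
case yv : (y v); [left|right]; apply/eqP/ffunP => u; rewrite ffunE;
  case: eqP => [->//|/eqP uv]; by rewrite h // !inE.
Qed.

Lemma sum_agree_setC1 v x h :
  \sum_(y | agree (~: [set v]) x y) h y = h (dn v x) + h (up v x).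
Proof.
rewrite (bigD1 (dn v x)) ?agree_setC1 ?eqxx ?orbT //=; congr (_ + _).
rewrite (bigD1 (up v x)) ?agree_setC1 ?eqxx ?up_neq_dn //= big1 ?addr0 // => y.
by rewrite agree_setC1; case: eqP => //; case: eqP; rewrite ?andbF.
Qed.

Definition heat_bath nu v h : config V -> R := fun x =>
  (nu (dn v x) * h (dn v x) + nu (up v x) * h (up v x)) /
  (nu (dn v x) + nu (up v x)).

Lemma heat_bathE nu v h : op (fun x => cond nu (~: [set v]) x) h =1 heat_bath nu v h.
Proof.
move=> x; rewrite /op /cond /heat_bath /pin_mass.
under eq_bigr => y _ do rewrite (fun_if (fun z => z * h y)) mul0r.
by rewrite -big_mkcond /= !sum_agree_setC1; ring.
Qed.

Lemma op_glauber nu h x :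
  op (glauber nu) h x = #|V|%:R^-1 * \sum_v heat_bath nu v h x.
Proof.
rewrite /op /glauber; under eq_bigr => y _ do rewrite -mulrA mulr_suml.
rewrite -mulr_sumr exchange_big /=; congr (_ * _).
by apply: eq_bigr => v _; rewrite -heat_bathE.
Qed.

Lemma heat_bath_scale (c : R) nu v h :
  c != 0 -> heat_bath (fun x => c * nu x) v h =1 heat_bath nu v h.
Proof.
move=> c0 x; rewrite /heat_bath -!mulrA -!mulrDr invfM mulrACA divff // mul1r.
by [].
Qed.

(** Agreement on [A] is an equivalence relation, so [x] and [y] in one class share the same
    normalising mass. *)
Lemma cond_reversible nu A x y :
  nu x * cond nu A x y = nu y * cond nu A y x.
Proof.
rewrite /cond (agree_sym A y); case: ifP => [axy|]; last by rewrite !mulr0.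
have -> : pin_mass nu A y = pin_mass nu A x.
  by apply: eq_bigl => z; rewrite (agree_trans _ axy).
by rewrite mulrCA.
Qed.

Lemma glauber_reversible nu x y :
  nu x * glauber nu x y = nu y * glauber nu y x.
Proof.
rewrite /glauber mulrCA [RHS]mulrCA; congr (_ * _).
by rewrite !mulr_sumr; apply: eq_bigr => v _; exact: cond_reversible.
Qed.

Lemma pin_mass_ge0 nu A x : (forall y, 0 <= nu y) -> 0 <= pin_mass nu A x.
Proof. by move=> nu0; apply: sumr_ge0. Qed.

Lemma cond_ge0 nu A x y : (forall y, 0 <= nu y) -> 0 <= cond nu A x y.
Proof.
by move=> nu0; rewrite /cond; case: ifP => // _; rewrite divr_ge0 ?pin_mass_ge0.
Qed.

Lemma sum_cond nu A x :
  \sum_y cond nu A x y = pin_mass nu A x / pin_mass nu A x.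
Proof. by rewrite -big_mkcond /= -mulr_suml. Qed.

Lemma sum_cond_le1 nu A x : \sum_y cond nu A x y <= 1.
Proof.
rewrite sum_cond; case: (eqVneq (pin_mass nu A x) 0) => [->|h].
  by rewrite mul0r ler01.
by rewrite divff.
Qed.

Lemma glauber_ge0 nu x y : (forall y, 0 <= nu y) -> 0 <= glauber nu x y.
Proof.
by move=> nu0; rewrite mulr_ge0 ?invr_ge0 ?ler0n // sumr_ge0 // => v _; exact: cond_ge0.
Qed.

Lemma sum_glauber_le1 nu x : \sum_y glauber nu x y <= 1.
Proof.
rewrite -mulr_sumr exchange_big /=.
case: (posnP #|V|) => [->|V0]; first by rewrite invr0 mul0r ler01.
rewrite mulrC ler_pdivrMr ?ltr0n // mul1r -[in leRHS]sum1_card natr_sum.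
by apply: ler_sum => v _; exact: sum_cond_le1.
Qed.

Lemma pin_mass_gt0 nu A x y :
  (forall z, 0 <= nu z) -> agree A x y -> 0 < nu y -> 0 < pin_mass nu A x.
Proof.
move=> nu0 axy ny; rewrite /pin_mass (bigD1 y) //= ltr_wpDr // sumr_ge0 //.
Qed.

Lemma agree_refl A x : agree A x x. Proof. exact/agreeP. Qed.

Lemma sum_glauber nu x : (0 < #|V|)%N -> (forall y, 0 <= nu y) -> 0 < nu x ->
  \sum_y glauber nu x y = 1.
Proof.
move=> V0 nu0 nx; rewrite -mulr_sumr exchange_big /=.
under eq_bigr => v _.
  rewrite sum_cond divff ?gt_eqF ?(pin_mass_gt0 nu0 (agree_refl _ x)) //; over.
by rewrite sumr_const mulVf // pnatr_eq0 -lt0n.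
Qed.

(** Detailed balance. Nonemptiness of [V] matters: otherwise the factor [#|V|%:R^-1] is 0 and the
    kernel vanishes. *)
Lemma glauber_stationary nu : (forall y, 0 <= nu y) -> (0 < #|V|)%N ->
  step (glauber nu) nu =1 nu.
Proof.
move=> nu0 V0 y; rewrite /step.
under eq_bigr => x _ do rewrite glauber_reversible.
rewrite -mulr_sumr; move: (nu0 y); rewrite le_eqVlt => /predU1P[<-|ny].
  by rewrite mul0r.
by rewrite sum_glauber ?mulr1.
Qed.

End HeatBath.

(** * Tilted weights and monotonicity *)

Section Averages.
Variable R : realFieldType.
Implicit Types a b m n t c : R.

(** Once denominators are cleared, only the term [m1 * n0 * (b0 - a1)] can be negative. The
    likelihood-ratio hypothesis lets [m0 * n1 * (b1 - a0)] absorb it, because [(b1 - a0) + (b0 - a1)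
    = (b0 - a0) + (b1 - a1)]. Values are compared only where both weights are positive, since
    monotonicity is known on the support alone. *)
Lemma two_point_average_le m0 m1 a0 a1 n0 n1 b0 b1 :
  0 <= m0 -> 0 <= m1 -> 0 <= n0 -> 0 <= n1 -> 0 < m0 + m1 -> 0 < n0 + n1 ->
  m1 * n0 <= n1 * m0 ->
  (0 < m0 -> 0 < n0 -> a0 <= b0) -> (0 < m1 -> 0 < n1 -> a1 <= b1) ->
  (0 < m0 -> 0 < n1 -> a0 <= b1) ->
  (m0 * a0 + m1 * a1) / (m0 + m1) <= (n0 * b0 + n1 * b1) / (n0 + n1).
Proof.
move=> m0p m1p n0p n1p mp np cross h00 h11 h01.
have weighted (p q x y : R) : 0 <= p -> 0 <= q -> (0 < p -> 0 < q -> x <= y) ->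
    0 <= p * q * (y - x).
  rewrite le_eqVlt => /predU1P[<-|p0]; first by rewrite !mul0r.
  rewrite le_eqVlt => /predU1P[<-|q0 /(_ p0 q0) xy]; first by rewrite mulr0 mul0r.
  by rewrite mulr_ge0 ?subr_ge0 // mulr_ge0 // ltW.
have A := weighted _ _ _ _ m0p n0p h00; have B := weighted _ _ _ _ m1p n1p h11.
have C : 0 <= m0 * n1 * (b1 - a0) + m1 * n0 * (b0 - a1).
  have D := weighted _ _ _ _ m0p n1p h01.
  move: (mulr_ge0 m1p n0p); rewrite le_eqVlt => /predU1P[<-|mn].
    by rewrite mul0r addr0.
  have mn' : 0 < m0 * n1 by rewrite mulrC; apply: lt_le_trans cross.
  have m1q : 0 < m1 by rewrite lt0r m1p andbT; apply: contraTneq mn => ->; rewrite mul0r ltxx.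
  have n0q : 0 < n0 by rewrite lt0r n0p andbT; apply: contraTneq mn => ->; rewrite mulr0 ltxx.
  have m0q : 0 < m0 by rewrite lt0r m0p andbT; apply: contraTneq mn' => ->; rewrite mul0r ltxx.
  have n1q : 0 < n1 by rewrite lt0r n1p andbT; apply: contraTneq mn' => ->; rewrite mulr0 ltxx.
  move: (h00 m0q n0q) (h11 m1q n1q) (h01 m0q n1q) => *; nra.
rewrite ler_pdivrMr // mulrAC ler_pdivlMr //.
rewrite -subr_ge0.
have -> : (n0 * b0 + n1 * b1) * (m0 + m1) - (m0 * a0 + m1 * a1) * (n0 + n1)
  = m0 * n0 * (b0 - a0) + m1 * n1 * (b1 - a1)
    + (m0 * n1 * (b1 - a0) + m1 * n0 * (b0 - a1)) by ring.
exact: addr_ge0 (addr_ge0 A B) C.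
Qed.

(* On the chain 0 < 1 < 2 with weights m0, c m1, (1 - c) m1, h takes the values
   h0, h1, h1; averaging h over the whole chain, versus averaging p over {0, 1}
   only, changes the correlation of p and h by
   (1 - c) m1 (h1 - avg h) (p2 - avg p), a product of nonnegative factors. *)
Lemma three_point_correlation m0 m1 t c h0 h1 p0 p1 p2 :
  0 <= m0 -> 0 <= m1 -> 0 < t -> 0 < c < 1 ->
  (0 < m0 -> 0 < m1 -> h0 <= h1) ->
  (0 < m0 -> 0 < m1 -> p0 <= p2) -> (0 < m1 -> p1 <= p2) ->
  let b := (m0 * h0 + m1 * h1) / (m0 + m1) in
  let a := (t * m0 * p0 + t * c * m1 * p1) / (t * m0 + t * c * m1) in
  t * m0 * (p0 * b) + t * c * m1 * (p1 * b) + (1 - c) / c * (t * c * m1 * (p2 * b))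
  <= t * m0 * (a * h0) + t * c * m1 * (a * h1)
     + (1 - c) / c * (t * c * m1 * (p2 * h1)).
Proof.
move=> m0p m1p t0 /andP[c0 c1] hh hp02 hp12 /=.
have cn : c != 0 by rewrite gt_eqF.
have tn : t != 0 by rewrite gt_eqF.
(* If [m0] or [m1] is 0, each average reduces to a single value and both sides coincide. *)
move: m0p m1p; rewrite le_eqVlt => /predU1P[<- | m0q]; last first.
  rewrite le_eqVlt => /predU1P[<- | m1q].
    have m0n : m0 != 0 by rewrite gt_eqF.
    by rewrite le_eqVlt; apply/orP; left; apply/eqP; field; rewrite ?tn ?cn ?m0n.
  have A : 0 < m0 + m1 by rewrite addr_gt0.
  have B : 0 < m0 + c * m1 by rewrite addr_gt0 // mulr_gt0.
  have B' : 0 < t * (m0 + c * m1) by rewrite mulr_gt0.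
  rewrite -subr_ge0.
  set X := (X in 0 <= X).
  have -> : X = (1 - c) * t * m1 * (m0 * (h1 - h0) / (m0 + m1)) *
    ((m0 * (p2 - p0) + c * m1 * (p2 - p1)) / (m0 + c * m1)).
    rewrite /X; field; rewrite cn !gt_eqF //.
    by move: B'; rewrite mulrDr mulrA.
  have := hh m0q m1q; have := hp02 m0q m1q; have := hp12 m1q => ? ? ?.
  have dh : 0 <= m0 * (h1 - h0) by rewrite mulr_ge0 ?subr_ge0 // ltW.
  have dp0 : 0 <= m0 * (p2 - p0) by rewrite mulr_ge0 ?subr_ge0 // ltW.
  have dp1 : 0 <= c * m1 * (p2 - p1) by rewrite mulr_ge0 ?subr_ge0 // ltW ?mulr_gt0.
  have w2 : 0 <= (1 - c) * t * m1 by rewrite ltW ?mulr_gt0 ?subr_gt0.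
  by rewrite mulr_ge0 ?divr_ge0 ?(ltW A) ?(ltW B) ?addr_ge0 // mulr_ge0 ?divr_ge0 ?(ltW A).
rewrite le_eqVlt => /predU1P[<- | m1q].
  by rewrite !(mul0r, mulr0, addr0).
have m1n : m1 != 0 by rewrite gt_eqF.
by rewrite le_eqVlt; apply/orP; left; apply/eqP; field; rewrite ?tn ?cn ?m1n.
Qed.

End Averages.

Section Tilted.
Variables (R : realFieldType) (V : finType) (mu : config V -> R).
Hypothesis mu0 : forall x, 0 <= mu x.
Hypothesis mu1 : 0 < mu (ones V).
Implicit Types (h : config V -> R) (x y : config V) (v : V) (L : {set V}) (c : R).

Definition le_config x y : Prop := forall v, x v -> y v.

Lemma agree_onesP L x : reflect {in L, forall v, x v} (agree L (ones V) x).
Proof. by apply: (iffP (agreeP _ _ _)) => h u uL; have := h u uL; rewrite ffunE. Qed.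

(** The tilted distribution pinned to 1 on [L], left unnormalised so that the weights for different
    [L] can be compared. *)
Definition weight c L x : R :=
  if agree L (ones V) x then mu x * c ^+ ones_count x else 0.

Lemma ones_count_up v x : ones_count (up v x) = (ones_count (dn v x)).+1.
Proof.
rewrite /ones_count (cardD1 v) inE up_at; congr _.+1; apply: eq_card => u.
by rewrite !inE !ffunE; case: eqP.
Qed.

Lemma agree_up v L x : v \notin L -> agree L (ones V) (up v x) = agree L (ones V) (dn v x).
Proof.
move=> vL; apply/agree_onesP/agree_onesP => h u uL; have := h u uL;
  by rewrite !ffunE; case: eqP uL vL => [-> ->|].
Qed.

Lemma agree_dn_in v L x : v \in L -> agree L (ones V) (dn v x) = false.
Proof. by move=> vL; apply/agree_onesP => /(_ v vL); rewrite dn_at. Qed.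

Lemma weight_ge0 c L x : 0 < c -> 0 <= weight c L x.
Proof.
by move=> c0; rewrite /weight; case: ifP => // _; rewrite mulr_ge0 // exprn_ge0 // ltW.
Qed.

Lemma weight_gt0 c L x : 0 < c -> 0 < mu x -> agree L (ones V) x -> 0 < weight c L x.
Proof. by move=> c0 mx; rewrite /weight => ->; rewrite mulr_gt0 // exprn_gt0. Qed.

Lemma weight_gt0E c L x : 0 < c -> 0 < weight c L x -> 0 < mu x /\ agree L (ones V) x.
Proof.
by move=> c0; rewrite /weight; case: ifP; rewrite ?ltxx // pmulr_lgt0 // exprn_gt0.
Qed.

Lemma sum_tilt_gt0 c : 0 < c -> 0 < \sum_y mu y * c ^+ ones_count y.
Proof.
move=> c0; rewrite (bigD1 (ones V)) //= ltr_wpDr ?mulr_gt0 ?exprn_gt0 //.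
by apply: sumr_ge0 => y _; rewrite mulr_ge0 // exprn_ge0 // ltW.
Qed.

Lemma cond_tilt c L x : 0 < c ->
  cond (tilt mu c) L (ones V) x = weight c L x / \sum_y weight c L y.
Proof.
move=> c0; rewrite /cond /tilt /pin_mass /weight -big_mkcond /= -mulr_suml.
case: ifP => _; last by rewrite mul0r.
by rewrite invf_div mulrA mulfVK // gt_eqF ?sum_tilt_gt0.
Qed.

Lemma heat_bath_cond_tilt c L v h : 0 < c ->
  heat_bath (cond (tilt mu c) L (ones V)) v h =1 heat_bath (weight c L) v h.
Proof.
move=> c0 x.
have -> : heat_bath (cond (tilt mu c) L (ones V)) v h x =
  heat_bath (fun y => (\sum_z weight c L z)^-1 * weight c L y) v h x.
  by rewrite /heat_bath !cond_tilt // ![(\sum_z _)^-1 * _]mulrC.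
case: (eqVneq (\sum_z weight c L z) 0) => [e|ne]; last first.
  by rewrite heat_bath_scale // invr_eq0.
have w0 y : weight c L y = 0.
  by apply: (psumr_eq0P _ e) => // z _; exact: weight_ge0.
by rewrite /heat_bath !w0 !(mulr0, mul0r).
Qed.

End Tilted.

(** * Heat baths and thinning preserve increasing functions *)

Section Monotone.
Variables (R : realFieldType) (V : finType) (mu : config V -> R).
Hypothesis mu0 : forall x, 0 <= mu x.
Hypothesis mu1 : 0 < mu (ones V).
Hypothesis mono : monotone_system mu.
Implicit Types (h : config V -> R) (x y : config V) (v : V) (L : {set V}) (c : R).

Lemma marg1E v x : marg1 mu (~: [set v]) x v = mu (up v x) / (mu (dn v x) + mu (up v x)).
Proof.
transitivity (op (fun x => cond mu (~: [set v]) x) (fun y : config V => (y v)%:R) x).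
  by rewrite /marg1 big_mkcond; apply: eq_bigr => y _; case: (y v); rewrite ?mulr1 ?mulr0.
by rewrite heat_bathE /heat_bath up_at dn_at mulr0 mulr1 add0r.
Qed.

Lemma up_dn_mass_gt0 v x : 0 < mu x -> 0 < mu (dn v x) + mu (up v x).
Proof.
by case: (up_or_dn v x) => {1}-> h; [rewrite ltr_wpDl|rewrite ltr_wpDr].
Qed.

(** This is the monotone-system inequality [p / (q + p) <= p' / (q' + p')] with the denominators
    cleared. *)
Lemma monotone_cross v x y : 0 < mu x -> 0 < mu y -> le_config x y ->
  mu (up v x) * mu (dn v y) <= mu (up v y) * mu (dn v x).
Proof.
move=> mx my xy; have px := up_dn_mass_gt0 v mx; have py := up_dn_mass_gt0 v my.
have := mono (v := v) (sigma := x) (tau := y).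
rewrite /pin_mass !sum_agree_setC1 !marg1E => /(_ px py).
have h u : u != v -> x u ==> y u by move=> _; apply/implyP/xy.
move/(_ h); rewrite ler_pdivrMr // mulrAC ler_pdivlMr //; nra.
Qed.

Lemma le_up v x y : le_config x y -> le_config (up v x) (up v y).
Proof. by move=> xy u; rewrite !ffunE => /orP[->|/xy ->] //; rewrite orbT. Qed.

Lemma le_dn v x y : le_config x y -> le_config (dn v x) (dn v y).
Proof. by move=> xy u; rewrite !ffunE => /andP[-> /xy ->]. Qed.

Lemma le_dn_up v x y : le_config x y -> le_config (dn v x) (up v y).
Proof. by move=> xy u; rewrite !ffunE => /andP[_ /xy ->]; rewrite orbT. Qed.

(* A pair (L, x) with L below x encodes a configuration on {0, 1, 2}, the sites
   of L being those in state 2. *)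
Definition lift_mono (phi : {set V} -> config V -> R) : Prop :=
  forall L L' x y, 0 < mu x -> 0 < mu y ->
    agree L (ones V) x -> agree L' (ones V) y ->
    L \subset L' -> le_config x y -> phi L x <= phi L' y.

Definition config_mono h : Prop :=
  forall x y, 0 < mu x -> 0 < mu y -> le_config x y -> h x <= h y.

(** The averages compare once the weights satisfy the cross inequality. For [v] in [L'] the lower
    state at [y] has weight 0 and it is trivial; otherwise [v] is outside [L] as well, the powers of
    [c] are the same on both sides, and it reduces to [monotone_cross]. *)
Lemma lift_mono_heat_bath c v phi : 0 < c -> lift_mono phi ->
  lift_mono (fun L => heat_bath (weight mu c L) v (phi L)).
Proof.
move=> c0 inc L L' x y mx my Lx Ly LL xy; rewrite /heat_bath.
have w0 M z := weight_ge0 mu0 M z c0.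
have wp M z : 0 < mu z -> agree M (ones V) z ->
    0 < weight mu c M (dn v z) + weight mu c M (up v z).
  move=> mz Mz; have := weight_gt0 c0 mz Mz.
  by case: (up_or_dn v z) => {1}-> h; [rewrite ltr_wpDl|rewrite ltr_wpDr].
have pos M z : 0 < weight mu c M z -> 0 < mu z /\ agree M (ones V) z.
  exact: weight_gt0E.
apply: two_point_average_le; rewrite ?w0 ?wp //.
- rewrite /weight; case: (boolP (v \in L')) => vL'.
    rewrite agree_dn_in // mulr0 mulr_ge0 //; first exact: (w0 L' (up v y)).
    exact: (w0 L (dn v x)).
  have vL : v \notin L by apply: contra vL'; apply: subsetP.
  rewrite !agree_up //; case: ifP => _; last first.
    by rewrite mul0r mulr0.
  case: ifP => _; last by rewrite mulr0 mul0r.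
  rewrite !ones_count_up !exprS; set p := c ^+ _; set q := c ^+ _.
  have -> : mu (up v x) * (c * p) * (mu (dn v y) * q) =
    c * p * q * (mu (up v x) * mu (dn v y)) by ring.
  have -> : mu (up v y) * (c * q) * (mu (dn v x) * p) =
    c * p * q * (mu (up v y) * mu (dn v x)) by ring.
  by rewrite ler_wpM2l ?monotone_cross // !mulr_ge0 ?exprn_ge0 // ltW.
- by move=> /pos[? ?] /pos[? ?]; apply: inc => //; exact: le_dn.
- by move=> /pos[? ?] /pos[? ?]; apply: inc => //; exact: le_up.
- by move=> /pos[? ?] /pos[? ?]; apply: inc => //; exact: le_dn_up.
Qed.

Lemma weight1 : weight mu 1 set0 =1 mu.
Proof.
move=> x; rewrite /weight expr1n mulr1; case: ifP => // /negP[].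
by apply/agree_onesP=> u; rewrite inE.
Qed.

Lemma config_mono_heat_bath v h : config_mono h -> config_mono (heat_bath mu v h).
Proof.
move=> inc x y mx my xy.
have a z : agree set0 (ones V) z by apply/agree_onesP=> u; rewrite inE.
(* The heat bath of [mu] is the lifted one without tilt ([c = 1]) and without frozen sites. *)
have := @lift_mono_heat_bath 1 v (fun _ => h) ltr01 _ set0 set0 x y mx my (a x) (a y).
rewrite /heat_bath !weight1; apply=> // L L' x' y' *; exact: inc.
Qed.

Lemma config_mono_glauber h : config_mono h -> config_mono (op (glauber mu) h).
Proof.
move=> inc x y mx my xy; rewrite !op_glauber ler_wpM2l ?invr_ge0 ?ler0n //.
by apply: ler_sum => v _; exact: config_mono_heat_bath.
Qed.

Lemma lift_mono_glauber c phi : 0 < c -> lift_mono phi ->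
  lift_mono (fun L => op (glauber (cond (tilt mu c) L (ones V))) (phi L)).
Proof.
move=> c0 inc L L' x y mx my Lx Ly LL xy.
rewrite !op_glauber ler_wpM2l ?invr_ge0 ?ler0n //.
apply: ler_sum => v _; rewrite !heat_bath_cond_tilt //.
exact: (lift_mono_heat_bath _ _ inc).
Qed.

(* Thinning with one common random set m for all x: this couples the selections
   at comparable configurations monotonically. *)
Lemma sum_fd_sel_prob c x (F : {set V} -> R) :
  \sum_(S : {set V}) fd_sel_prob c x S * F (~: S) =
  \sum_(m : config V) (\prod_v (if m v then 1 - c else c)) * F [set v | m v && x v].
Proof.
rewrite [RHS](partition_big (fun m : config V => ~: [set v | m v && x v]) predT) //=.
apply: eq_bigr => S _.
have -> : \sum_(m : config V | ~: [set v | m v && x v] == S)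
    (\prod_v (if m v then 1 - c else c)) * F [set v | m v && x v] =
  \sum_(m : config V | ~: [set v | m v && x v] == S)
    (\prod_v (if m v then 1 - c else c)) * F (~: S).
  by apply: eq_bigr => m /eqP <-; rewrite setCK.
rewrite -mulr_suml; congr (_ * _); rewrite /fd_sel_prob.
(* The set of [m] that produce a given [S] is a product over sites, cut out at [v] by [Q v], so the
   sum of products factorises. *)
pose Q v b := b && x v == (v \notin S).
transitivity (\prod_v \sum_(b | Q v b) (if b then 1 - c else c)).
  apply: eq_bigr => v _; rewrite /Q big_mkcond big_bool /= !(eq_sym _ (v \notin S)).
  by case: (x v); case: (v \in S); rewrite /= ?addr0 ?add0r // subrK.
rewrite (bigA_distr_big_dep Q); apply: eq_bigl => m.
apply/familyP/eqP => [h|e v].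
  apply/setP=> v; have /eqP : m v && x v == (v \notin S) := h v.
  by rewrite !inE => ->; rewrite negbK.
by change (m v && x v == (v \notin S)); rewrite -e !inE negbK.
Qed.

Lemma config_mono_thinning c phi : 0 < c < 1 -> lift_mono phi ->
  config_mono (fun x => \sum_(S : {set V}) fd_sel_prob c x S * phi (~: S) x).
Proof.
move=> /andP[c0 c1] inc x y mx my xy.
rewrite (sum_fd_sel_prob c x (fun L => phi L x)) (sum_fd_sel_prob c y (fun L => phi L y)).
apply: ler_sum => m _; apply: ler_wpM2l.
  by apply: prodr_ge0 => v _; case: ifP => _; rewrite ltW ?subr_gt0.
apply: inc => //.
- by apply/agree_onesP => v; rewrite inE => /andP[].
- by apply/agree_onesP => v; rewrite inE => /andP[].
- by apply/subsetP => v; rewrite !inE => /andP[-> /xy].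
Qed.

End Monotone.

(** * Comparison of the two dynamics *)

Section Blocks.
Variables (R : realFieldType) (V : finType) (mu : config V -> R) (theta : R).
Hypothesis mu0 : forall x, 0 <= mu x.
Hypothesis mu1 : 0 < mu (ones V).
Hypothesis mono : monotone_system mu.
Hypothesis theta01 : 0 < theta < 1.
Implicit Types (h e f : config V -> R) (x y z : config V) (v : V) (L S : {set V}).

Let theta0 : 0 < theta. Proof. by case/andP: theta01. Qed.

(** [weight] charges [theta] for every one; this factor corrects it to [1 - theta] at the sites in
    state 2. *)
Definition set_coef L : R := \prod_v (if v \in L then (1 - theta) / theta else 1).

Lemma set_coef_ge0 L : 0 <= set_coef L.
Proof.
apply: prodr_ge0 => v _; case: ifP => // _.
by rewrite divr_ge0 ?(ltW theta0) // subr_ge0 ltW //; case/andP: theta01.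
Qed.

Lemma set_coefU v L : v \notin L -> set_coef (v |: L) = (1 - theta) / theta * set_coef L.
Proof.
move=> /negPf vL; rewrite /set_coef (bigD1 v) //= [in RHS](bigD1 v) //=.
rewrite setU11 vL mul1r; congr (_ * _).
by apply: eq_bigr => u /negPf uv; rewrite in_setU1 uv.
Qed.

(** The joint law of a configuration and its selected set is the weight on {0, 1, 2}. Both sides
    vanish if [x] has a zero outside [S], as zeros are always selected. *)
Lemma fd_sel_prob_weight x S :
  mu x * fd_sel_prob theta x S = set_coef (~: S) * weight mu theta (~: S) x.
Proof.
rewrite /weight; case: ifP => [/agree_onesP Sx|/negbT Sx]; last first.
  have [v vS xv] : exists2 v, v \in ~: S & ~~ x v.
    move: Sx; rewrite negb_forall_in => /existsP[v /andP[vS]].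
    by rewrite ffunE => h; exists v => //; apply: contra h => ->.
  rewrite mulr0 /fd_sel_prob (bigD1 v) //= (negPf xv).
  by move: vS; rewrite inE => /negPf ->; rewrite mul0r mulr0.
rewrite mulrCA; congr (_ * _).
have -> : theta ^+ ones_count x = \prod_v (if x v then theta else 1).
  rewrite -big_mkcond /= prodr_const /ones_count; congr (_ ^+ _).
  by apply: eq_card => v; rewrite inE.
rewrite -big_split /=; apply: eq_bigr => v _; have := Sx v; rewrite inE.
have tn : theta != 0 by rewrite gt_eqF.
case: (v \in S) => /= [_|->//]; last by rewrite divfK.
by rewrite mul1r.
Qed.

Lemma fd_sel_prob_ge0 x S : 0 <= fd_sel_prob theta x S.
Proof.
apply: prodr_ge0 => v _; case: ifP => _; case: ifP => _ //; rewrite ltW //.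
by rewrite subr_gt0; case/andP: theta01.
Qed.

Lemma sum_fd_sel_prob1 x : \sum_S fd_sel_prob theta x S = 1.
Proof.
have := sum_fd_sel_prob theta x (fun _ => 1).
under eq_bigr => S _ do rewrite mulr1.
move=> ->; under eq_bigr => m _ do rewrite mulr1.
pose F (v : V) (b : bool) := if b then 1 - theta else theta.
rewrite -(bigA_distr_bigA F) /= big1 // => v _.
by rewrite big_bool /= subrK.
Qed.

Lemma fd_sel_prob_agree x S : 0 < mu x -> fd_sel_prob theta x S != 0 ->
  agree (~: S) (ones V) x.
Proof.
move=> mx; apply: contraNT => /negPf nx; have := fd_sel_prob_weight x S.
rewrite /weight nx mulr0 => /eqP; rewrite mulf_eq0 => /orP[|//].
by rewrite gt_eqF.
Qed.

(** The expectation of [phi * psi] under the lift of [mu] to {0, 1, 2}. *)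
Definition corr (phi psi : {set V} -> config V -> R) : R :=
  \sum_L \sum_x set_coef L * weight mu theta L x * (phi L x * psi L x).

Lemma corr_thinning phi h :
  corr phi (fun _ => h) = \sum_x mu x *
    (\sum_(S : {set V}) fd_sel_prob theta x S * phi (~: S) x) * h x.
Proof.
rewrite /corr (reindex_inj (@setC_inj V)) exchange_big /=; apply: eq_bigr => x _.
rewrite mulr_sumr mulr_suml; apply: eq_bigr => S _.
by rewrite -fd_sel_prob_weight; ring.
Qed.

Lemma sum_config_split v h :
  \sum_x h x = \sum_(x : config V | ~~ x v) (h x + h (up v x)).
Proof.
rewrite (bigID (fun x : config V => ~~ x v)) /= big_split /=; congr (_ + _).
rewrite (reindex_onto (up v) (dn v)) /=; last first.
  by move=> x /negPn xv; rewrite up_dn up_id.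
apply: eq_bigl => x; rewrite up_at /= dn_up.
by apply/eqP/idP => [<-|xv]; rewrite ?dn_at // dn_id.
Qed.

Lemma sum_set_split v (F : {set V} -> R) :
  \sum_L F L = \sum_(L : {set V} | v \notin L) (F L + F (v |: L)).
Proof.
rewrite (bigID (fun L : {set V} => v \notin L)) /= big_split /=; congr (_ + _).
rewrite (reindex_onto (fun L : {set V} => v |: L) (fun L => L :\ v)) /=.
  apply: eq_bigl => L; rewrite negbK setU11 /=.
  apply/eqP/idP => [<-|vL]; first by rewrite !inE eqxx.
  by rewrite setU1K.
by move=> L; rewrite negbK => vL; rewrite setD1K.
Qed.

(** Group the lifted configurations by their values off [v]. Each group is a chain [(L, z)],
    [(L, up v z)], [(v |: L, up v z)], the fourth combination [(v |: L, z)] having weight 0, and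
    [three_point_correlation] applies to it. *)
Lemma corr_heat_bath v phi h : lift_mono mu phi -> config_mono mu h ->
  corr phi (fun _ => heat_bath mu v h) <=
  corr (fun L => heat_bath (weight mu theta L) v (phi L)) (fun _ => h).
Proof.
move=> pm hm; rewrite /corr.
rewrite (sum_set_split v) [leRHS](sum_set_split v); apply: ler_sum => L vL.
rewrite (sum_config_split v) [in leRHS](sum_config_split v).
rewrite [in X in _ + X <= _](sum_config_split v) [in X in _ <= _ + X](sum_config_split v).
rewrite -!big_split /=; apply: ler_sum => z zv.
have tn : theta != 0 by rewrite gt_eqF.
have dz : dn v z = z by rewrite dn_id.
have duz : dn v (up v z) = z by rewrite dn_up dz.
have uuz : up v (up v z) = up v z by rewrite up_id // up_at.
have vL' : v \in v |: L by rewrite setU11.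
have w0 : weight mu theta (v |: L) z = 0.
  by rewrite /weight -dz agree_dn_in.
have Lu : agree L (ones V) (up v z) = agree L (ones V) z.
  by rewrite agree_up // dz.
have vLu : agree (v |: L) (ones V) (up v z) = agree L (ones V) z.
  rewrite -Lu; apply/agree_onesP/agree_onesP => H u uL.
    by apply: H; rewrite in_setU1 uL orbT.
  by move: uL; rewrite in_setU1 => /predU1P[->|/H //]; rewrite up_at.
have w2 : weight mu theta (v |: L) (up v z) = weight mu theta L (up v z).
  by rewrite /weight vLu Lu.
rewrite w0 w2 set_coefU // /heat_bath duz uuz dz w0 w2 !mul0r !mulr0 !add0r.
set t := theta ^+ ones_count z.
have t0 : 0 < t by rewrite exprn_gt0.
case: (boolP (agree L (ones V) z)) => Lz; last first.
  by rewrite /weight Lu (negPf Lz) !mul0r !mulr0 !mul0r !addr0.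
have -> : weight mu theta L z = t * mu z by rewrite /weight Lz mulrC.
have -> : weight mu theta L (up v z) = t * theta * mu (up v z).
  rewrite /weight Lu Lz ones_count_up dz exprS -/t; ring.
have up_phi : 0 < mu (up v z) -> phi L (up v z) <= phi (v |: L) (up v z).
  by move=> m1; apply: pm => //; rewrite ?Lu ?vLu // subsetU1.
have zu : le_config z (up v z) by move=> u; rewrite ffunE => ->; rewrite orbT.
have hm01 : 0 < mu z -> 0 < mu (up v z) -> h z <= h (up v z).
  by move=> m0 m1; apply: hm.
have pm02 : 0 < mu z -> 0 < mu (up v z) -> phi L z <= phi (v |: L) (up v z).
  by move=> m0 m1; apply: pm => //; rewrite ?vLu // subsetU1.
have := three_point_correlation (mu0 z) (mu0 _) t0 theta01 hm01 pm02 up_phi.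
cbv zeta; set b := (_ / _); set a := (_ / _); set m2 := t * theta * mu (up v z).
have e : m2 * (m2 * phi (v |: L) (up v z) / m2) = m2 * phi (v |: L) (up v z).
  case: (eqVneq m2 0) => [->|m2n]; first by rewrite !mul0r.
  by field.
move/(ler_wpM2l (set_coef_ge0 L)); rewrite !mul0r !add0r.
have -> : m2 * (phi (v |: L) (up v z) * h (up v z)) =
    m2 * (m2 * phi (v |: L) (up v z) / m2) * h (up v z) by rewrite e mulrA.
by move=> H; congr (is_true (_ <= _)): H; ring.
Qed.

End Blocks.

(** * Kernels that are stochastic on a support *)

Section Stochastic.
Variables (R : realFieldType) (V : finType).
Implicit Types (P : config V -> config V -> R) (nu h : config V -> R).

Definition stochastic_on nu P : Prop :=
  [/\ forall x y, 0 <= P x y,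
      forall x y, 0 < nu x -> P x y != 0 -> 0 < nu y
    & forall x, 0 < nu x -> \sum_y P x y = 1].

Lemma op_le_on nu P h (b : R) x : stochastic_on nu P -> 0 < nu x ->
  (forall y, 0 < nu y -> h y <= b) -> op P h x <= b.
Proof.
move=> [P0 Pn P1] nx hb; rewrite -[leRHS]mul1r -(P1 _ nx) mulr_suml.
apply: ler_sum => y _; case: (eqVneq (P x y) 0) => [->|/(Pn _ _ nx) ny].
  by rewrite !mul0r.
by rewrite ler_wpM2l ?hb.
Qed.

Lemma opN P h x : op P (fun y => - h y) x = - op P h x.
Proof. by rewrite /op -sumrN; apply: eq_bigr => y _; rewrite mulrN. Qed.

Lemma op_norm_le_on nu P h1 h2 (b : R) x : stochastic_on nu P -> 0 < nu x ->
  (forall y, 0 < nu y -> `|h1 y - h2 y| <= b) -> `|op P h1 x - op P h2 x| <= b.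
Proof.
move=> st nx hb.
have -> : op P h1 x - op P h2 x = op P (fun y => h1 y - h2 y) x.
  by rewrite /op -sumrB; apply: eq_bigr => y _; rewrite mulrBr.
have bd y : 0 < nu y -> - b <= h1 y - h2 y <= b by move=> /hb; rewrite ler_norml.
rewrite ler_norml lerNl -opN !(op_le_on st nx) // => y /bd /andP[]; lra.
Qed.

Lemma sum_dist_after_on nu P x t : stochastic_on nu P -> 0 < nu x ->
  \sum_y dist_after P x t y = 1.
Proof.
move=> st nx; under eq_bigr => y _ do rewrite -[dist_after _ _ _ _]mulr1.
rewrite (dist_after_op P x t (fun _ => 1)).
suff H y : 0 < nu y -> iter t (op P) (fun _ => 1) y = 1 by exact: H.
elim: t y => [//|t IH] y ny; rewrite iterS /op; have [_ Pn P1] := st.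
rewrite -[RHS](P1 _ ny); apply: eq_bigr => z _.
case: (eqVneq (P y z) 0) => [->|/(Pn _ _ ny) nz]; first by rewrite mul0r.
by rewrite IH // mulr1.
Qed.

Lemma op_01 P h x : (forall x y, 0 <= P x y) -> (forall x, \sum_y P x y <= 1) ->
  (forall y, 0 <= h y <= 1) -> 0 <= op P h x <= 1.
Proof.
move=> P0 P1 h01; apply/andP; split.
  by apply: sumr_ge0 => y _; rewrite mulr_ge0 //; case/andP: (h01 y).
apply: le_trans (P1 x); apply: ler_sum => y _.
by rewrite -[leRHS]mulr1 ler_wpM2l //; case/andP: (h01 y).
Qed.

Lemma iter_op_01 P h t x : (forall x y, 0 <= P x y) -> (forall x, \sum_y P x y <= 1) ->
  (forall y, 0 <= h y <= 1) -> 0 <= iter t (op P) h x <= 1.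
Proof. by move=> P0 P1 h01; elim: t x => [|t IH] x //=; exact: op_01. Qed.

Lemma glauber_stochastic_on nu : (0 < #|V|)%N -> (forall y, 0 <= nu y) ->
  stochastic_on nu (glauber nu).
Proof.
move=> V0 nu0; split; [by move=> *; exact: glauber_ge0| |by move=> *; exact: sum_glauber].
move=> x y nx; apply: contraNT; rewrite -leNgt => ny.
have ny0 : nu y = 0 by apply/le_anti; rewrite ny nu0.
rewrite /glauber big1 ?mulr0 // => v _.
by rewrite /cond ny0 mul0r; case: ifP.
Qed.

(** By reversibility the density of the law at time [t] with respect to [nu] is, up to the factor
    [nu x], an iterate of the indicator of the start, so monotonicity of observables passes to
    it. *)
Lemma dist_after_reversible nu P x y t :
  (forall x y, nu x * P x y = nu y * P y x) ->
  nu x * dist_after P x t y = nu y * iter t (op P) (dirac R x) y.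
Proof.
move=> rev; elim: t y => [|t IH] y /=.
  rewrite /dist_after /= /dirac; case: eqP => [->//|_]; by rewrite !mulr0.
rewrite /step mulr_sumr /op mulr_sumr; apply: eq_bigr => z _.
by rewrite mulrA -/(dist_after P x t) IH mulrAC rev -!mulrA; congr (_ * _).
Qed.

End Stochastic.

(** * From one heat bath to rounds of the field dynamics *)

Section Comparison.
Variables (R : realFieldType) (V : finType) (mu : config V -> R) (theta : R).
Hypothesis mu0 : forall x, 0 <= mu x.
Hypothesis mu1 : 0 < mu (ones V).
Hypothesis mono : monotone_system mu.
Hypothesis theta01 : 0 < theta < 1.
Implicit Types (h e f : config V -> R) (x y z : config V) (v : V) (L S : {set V}).

Let theta0 : 0 < theta. Proof. by case/andP: theta01. Qed.

Definition tilted_dist L := cond (tilt mu theta) L (ones V).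
Definition tilted_glauber L := glauber (tilted_dist L).

Lemma corr_glauber phi h : lift_mono mu phi -> config_mono mu h ->
  corr mu theta phi (fun _ => op (glauber mu) h) <=
  corr mu theta (fun L => op (tilted_glauber L) (phi L)) (fun _ => h).
Proof.
move=> pm hm.
have -> : corr mu theta phi (fun _ => op (glauber mu) h) =
    #|V|%:R^-1 * \sum_v corr mu theta phi (fun _ => heat_bath mu v h).
  rewrite /corr [in RHS]exchange_big mulr_sumr; apply: eq_bigr => L _ /=.
  rewrite [in RHS]exchange_big mulr_sumr; apply: eq_bigr => x _ /=.
  by rewrite op_glauber -!mulr_sumr; ring.
have -> : corr mu theta (fun L => op (tilted_glauber L) (phi L)) (fun _ => h) =
    #|V|%:R^-1 * \sum_v corr mu theta
       (fun L => heat_bath (weight mu theta L) v (phi L)) (fun _ => h).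
  rewrite /corr [in RHS]exchange_big mulr_sumr; apply: eq_bigr => L _ /=.
  rewrite [in RHS]exchange_big mulr_sumr; apply: eq_bigr => x _ /=.
  rewrite op_glauber -mulr_sumr -mulr_suml.
  by under eq_bigr => v _ do rewrite heat_bath_cond_tilt //; ring.
by rewrite ler_wpM2l ?invr_ge0 ?ler0n // ler_sum // => v _; exact: corr_heat_bath.
Qed.

Lemma config_mono_iter k h : config_mono mu h -> config_mono mu (iter k (op (glauber mu)) h).
Proof. by move=> hm; elim: k => [//|k IH] /=; exact: config_mono_glauber. Qed.

Lemma lift_mono_iter k phi : lift_mono mu phi ->
  lift_mono mu (fun L => iter k (op (tilted_glauber L)) (phi L)).
Proof. by move=> pm; elim: k => [//|k IH] /=; exact: lift_mono_glauber. Qed.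

(** Each induction step moves one Glauber step from the right factor to the left one, where it
    becomes frozen; both factors remain increasing. *)
Lemma corr_iter_glauber k phi h : lift_mono mu phi -> config_mono mu h ->
  corr mu theta phi (fun _ => iter k (op (glauber mu)) h) <=
  corr mu theta (fun L => iter k (op (tilted_glauber L)) (phi L)) (fun _ => h).
Proof.
elim: k phi => [//|k IH] phi pm hm.
apply: le_trans (corr_glauber pm (config_mono_iter k hm)) _.
have := IH _ (lift_mono_glauber mu0 mu1 mono theta0 pm) hm.
by under [X in _ <= X -> _]eq_bigr => L _ do rewrite -iterSr.
Qed.

(* One round of field dynamics whose resampling step is replaced by k steps of
   Glauber dynamics on the tilted conditional distribution. *)
Definition block k f : config V -> R := fun x =>
  \sum_S fd_sel_prob theta x S * iter k (op (tilted_glauber (~: S))) f x.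

Lemma lift_mono_const f : config_mono mu f -> lift_mono mu (fun _ => f).
Proof. by move=> fm L L' x y mx my _ _ _; exact: fm. Qed.

Lemma config_mono_block k f : config_mono mu f -> config_mono mu (block k f).
Proof.
by move=> fm; apply: (config_mono_thinning theta01 (lift_mono_iter k (lift_mono_const fm))).
Qed.

(** Start from [phi] independent of [L]: selection probabilities sum to 1, so the lifted correlation
    on the left is an expectation under [mu], while on the right summing over [L] produces
    [block]. *)
Lemma block_le k f e : config_mono mu f -> config_mono mu e ->
  \sum_x mu x * f x * iter k (op (glauber mu)) e x <= \sum_x mu x * block k f x * e x.
Proof.
move=> fm em; have := corr_iter_glauber k (lift_mono_const fm) em.
rewrite !corr_thinning //=.
by under eq_bigr => x _ do rewrite -mulr_suml sum_fd_sel_prob1 mul1r.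
Qed.

(** [block_le] trades [k] Glauber steps for one block, and since the block is again increasing this
    can be repeated. *)
Lemma blocks_le j k f e : config_mono mu f -> config_mono mu e ->
  \sum_x mu x * f x * iter (j * k) (op (glauber mu)) e x <=
  \sum_x mu x * iter j (block k) f x * e x.
Proof.
elim: j f => [//|j IH] f fm em; rewrite mulSn iterD iterSr.
apply: le_trans (block_le k fm (config_mono_iter (j * k) em)) _.
exact: IH (config_mono_block k fm) em.
Qed.

Lemma sum_weight_gt0 L x : 0 < mu x -> agree L (ones V) x ->
  0 < \sum_y weight mu theta L y.
Proof.
move=> mx Lx; rewrite (bigD1 x) //= ltr_wpDr ?weight_gt0 //.
by apply: sumr_ge0 => y _; exact: weight_ge0.
Qed.

Lemma tilted_distE L x :
  tilted_dist L x = weight mu theta L x / \sum_y weight mu theta L y.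
Proof. exact: cond_tilt. Qed.

Lemma tilted_dist_ge0 L x : 0 <= tilted_dist L x.
Proof.
by rewrite tilted_distE divr_ge0 ?sumr_ge0 // => *; exact: weight_ge0.
Qed.

Lemma sum_tilted_dist L x : 0 < mu x -> agree L (ones V) x -> \sum_y tilted_dist L y = 1.
Proof.
move=> mx Lx; under eq_bigr => y _ do rewrite tilted_distE.
by rewrite -mulr_suml divff // gt_eqF // (sum_weight_gt0 mx Lx).
Qed.

Lemma tilted_dist_gt0 L x : 0 < mu x -> agree L (ones V) x -> 0 < tilted_dist L x.
Proof.
by move=> mx Lx; rewrite tilted_distE divr_gt0 ?weight_gt0 ?(sum_weight_gt0 mx Lx).
Qed.

Lemma field_dynamics_ge0 x y : 0 <= field_dynamics mu theta x y.
Proof.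
apply: sumr_ge0 => S _; rewrite mulr_ge0 ?fd_sel_prob_ge0 //; exact: tilted_dist_ge0.
Qed.

Lemma sum_field_dynamics_le1 x : \sum_y field_dynamics mu theta x y <= 1.
Proof.
rewrite exchange_big /= -(sum_fd_sel_prob1 theta x); apply: ler_sum => S _.
rewrite -mulr_sumr -[leRHS]mulr1 ler_wpM2l ?fd_sel_prob_ge0 //; exact: sum_cond_le1.
Qed.

Lemma field_dynamics_stochastic_on : stochastic_on mu (field_dynamics mu theta).
Proof.
split; first exact: field_dynamics_ge0.
  move=> x y _; apply: contraNT; rewrite -leNgt => my.
  have my0 : mu y = 0 by apply/le_anti; rewrite my mu0.
  rewrite /field_dynamics big1 // => S _.
  by rewrite -/(tilted_dist _ _) tilted_distE /weight my0 mul0r if_same mul0r mulr0.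
move=> x mx; rewrite exchange_big /= -[RHS](sum_fd_sel_prob1 theta x).
apply: eq_bigr => S _; rewrite -mulr_sumr.
case: (eqVneq (fd_sel_prob theta x S) 0) => [->|n0]; first by rewrite mul0r.
by rewrite (sum_tilted_dist mx) ?mulr1 // (fd_sel_prob_agree theta01 mx).
Qed.

(** For each fixed [S], resampling draws from the normalised joint weight of the configuration and
    [S], and hence preserves it. *)
Lemma field_dynamics_stationary : step (field_dynamics mu theta) mu =1 mu.
Proof.
move=> y; rewrite /step.
under eq_bigr => x _ do rewrite /field_dynamics mulr_sumr.
rewrite exchange_big /= -[RHS]mulr1 -(sum_fd_sel_prob1 theta y) mulr_sumr.
apply: eq_bigr => S _.
under eq_bigr => x _ do rewrite mulrA (fd_sel_prob_weight mu theta01).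
rewrite -mulr_suml -mulr_sumr fd_sel_prob_weight // -mulrA; congr (_ * _).
rewrite -/(tilted_dist _ _) tilted_distE.
set Z := \sum_x _; case: (eqVneq Z 0) => [Z0|Zn]; last by rewrite mulrCA divff ?mulr1.
rewrite Z0 mul0r; apply/esym.
by apply: (psumr_eq0P _ Z0) => // z _; exact: weight_ge0.
Qed.

(** * Error of replacing exact resampling by Glauber steps *)

Section Error.
Variables (k : nat) (delta : R).
Hypothesis V0 : (0 < #|V|)%N.
Hypothesis tilted_mixed : forall L x, 0 < mu x -> agree L (ones V) x ->
  dTV (dist_after (tilted_glauber L) x k) (tilted_dist L) <= delta.

(** Any [S] of nonzero selection probability leaves [x] feasible for the pinning on its complement,
    so the mixing hypothesis applies from the start [x]. *)
Lemma block_field_dynamics f x : 0 < mu x -> (forall y, 0 <= f y <= 1) ->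
  `|block k f x - op (field_dynamics mu theta) f x| <= delta.
Proof.
move=> mx f01.
have -> : op (field_dynamics mu theta) f x =
    \sum_S fd_sel_prob theta x S * \sum_y tilted_dist (~: S) y * f y.
  rewrite /op; under eq_bigr => y _ do rewrite /field_dynamics mulr_suml.
  rewrite exchange_big /=; apply: eq_bigr => S _; rewrite mulr_sumr.
  by apply: eq_bigr => y _; rewrite mulrA.
rewrite -sumrB; apply: le_trans (ler_norm_sum _ _ _) _.
rewrite -[leRHS]mul1r -(sum_fd_sel_prob1 theta x) mulr_suml.
apply: ler_sum => S _; rewrite -mulrBr normrM ger0_norm ?fd_sel_prob_ge0 //.
case: (eqVneq (fd_sel_prob theta x S) 0) => [->|n0]; first by rewrite !mul0r.
have Sx := fd_sel_prob_agree theta01 mx n0.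
rewrite ler_wpM2l ?fd_sel_prob_ge0 // -dist_after_op.
apply: le_trans (tilted_mixed mx Sx); apply: expectation_dTV => //.
rewrite (sum_tilted_dist mx Sx) (sum_dist_after_on (nu := tilted_dist (~: S))) //.
  by apply: glauber_stochastic_on => // y; exact: tilted_dist_ge0.
exact: tilted_dist_gt0.
Qed.

Lemma iter_block_01 j f x : (forall y, 0 <= f y <= 1) -> 0 <= iter j (block k) f x <= 1.
Proof.
move=> f01; elim: j x => [//|j IH] x; rewrite iterS /block.
have G01 S : 0 <= iter k (op (tilted_glauber (~: S))) (iter j (block k) f) x <= 1.
  apply: iter_op_01 => // *; last exact: sum_glauber_le1.
  by apply: glauber_ge0 => y; exact: tilted_dist_ge0.
apply/andP; split.
  by apply: sumr_ge0 => S _; rewrite mulr_ge0 ?fd_sel_prob_ge0 //; case/andP: (G01 S).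
rewrite -(sum_fd_sel_prob1 theta x); apply: ler_sum => S _.
by rewrite -[leRHS]mulr1 ler_wpM2l ?fd_sel_prob_ge0 //; case/andP: (G01 S).
Qed.

(** Errors add up: each round contributes [delta], and the field dynamics does not enlarge earlier
    errors. *)
Lemma iter_block_field_dynamics j f x : 0 < mu x -> (forall y, 0 <= f y <= 1) ->
  `|iter j (block k) f x - iter j (op (field_dynamics mu theta)) f x| <= j%:R * delta.
Proof.
move=> mx f01; elim: j x mx => [|j IH] x mx; first by rewrite subrr normr0 mul0r.
rewrite !iterS; set g := iter j (block k) f.
apply: le_trans (ler_distD (op (field_dynamics mu theta) g x) _ _) _.
rewrite -natr1 mulrDl mul1r addrC lerD //.
  exact: (op_norm_le_on field_dynamics_stochastic_on).
by apply: block_field_dynamics => // y; exact: iter_block_01.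
Qed.

End Error.
End Comparison.

(* Mixing times are option nat, None meaning "infinite". *)
Theorem theorem1p9 (R : realFieldType) (V : finType) (mu : config V -> R)
  (theta eps : R) :
  is_dist mu -> monotone_system mu ->
  0 < mu (ones V) ->
  0 < theta < 1 -> 0 < eps < 1 ->
  forall T1 T2 : nat,
    TFD mu theta (eps / 2) = Some T1 ->
    Ttilted mu theta (eps / (2 * T1%:R)) = Some T2 ->
    exists T0 : nat, TGD_from mu (ones V) eps = Some T0 /\ (T0 <= T1 * T2)%N.
Proof.
move=> [mu0 mu_sum] mono mu1 theta01 /andP[eps0 _] T1 T2 hFD hT.
(* For empty [V] the Glauber kernel is 0, but the only configuration already has law [mu] at time
   0. *)
have [V0|V0] := posnP #|V|.
  have all1 (x : config V) : x = ones V.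
    by apply/ffunP => v; have := card0_eq V0 v; rewrite inE.
  have mu_ones : mu (ones V) = 1.
    by rewrite -mu_sum (bigD1 (ones V)) //= big1 ?addr0 // => x; rewrite -(all1 x) eqxx.
  suff [s [hs s0]] : exists s, TGD_from mu (ones V) eps = Some s /\ (s <= 0)%N.
    by exists s; split=> //; apply: leq_trans s0 _.
  apply: first_time_le.
  rewrite /dTV big1 ?mulr0 ?(ltW eps0) // => x _.
  by rewrite (all1 x) mu_ones /dist_after /= /dirac eqxx subrr normr0.
apply: first_time_le.
set delta := eps / _ in hT.
have tilted_mixed L x : 0 < mu x -> agree L (ones V) x ->
    dTV (dist_after (tilted_glauber mu theta L) x T2) (tilted_dist mu theta L) <= delta.
  move=> mx Lx.
  (* [x] itself witnesses that the pinning on [L] is feasible, so both maxima in [Ttilted] cover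
     it. *)
  have [t [ht tT]] := omax_Some hT (pin_mass_gt0 mu0 Lx mx).
  have [s [hs st]] := omax_Some ht (tilted_dist_gt0 mu0 mu1 theta01 mx Lx).
  apply: le_trans (first_time_Some hs).
  have t0 := tilted_dist_ge0 mu0 mu1 theta01 L.
  apply: dTV_dist_after_le (leq_trans st tT).
  - by move=> *; exact: glauber_ge0.
  - by move=> *; exact: sum_glauber_le1.
  - exact: glauber_stationary.
have FD_mixed : dTV (dist_after (field_dynamics mu theta) (ones V) T1) mu <= eps / 2.
  have [t [ht tT]] := omax_Some hFD mu1.
  apply: le_trans (first_time_Some ht); apply: dTV_dist_after_le tT.
  - exact: field_dynamics_ge0.
  - exact: sum_field_dynamics_le1.
  - exact: field_dynamics_stationary.
set T := (T1 * T2)%N; set nu := dist_after (glauber mu) (ones V) T.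
(* [e] is the starting density up to a constant, and [f] the event on which the distance of [nu] and
   [mu] is attained. *)
pose e := dirac R (ones V); pose f x : R := (mu x < nu x)%R%:R.
have nuE y : mu (ones V) * nu y = mu y * iter T (op (glauber mu)) e y.
  by apply: dist_after_reversible; exact: glauber_reversible.
have em : config_mono mu e.
  move=> x y _ _ xy; rewrite /e /dirac; case: (eqVneq x (ones V)) => [xe|_].
    suff -> : y = ones V by rewrite eqxx.
    by apply/ffunP => v; rewrite ffunE; apply: xy; rewrite xe ffunE.
  by case: ifP.
have fm : config_mono mu f.
  move=> x y mx my xy; rewrite /f; case: ltP => [hx|_]; last by rewrite ler0n.
  suff -> : mu y < nu y by [].
  (* On the support, [mu x < nu x] says that the iterate of [e] at [x] exceeds [mu (ones V)], a
     condition preserved upwards. *)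
  move: hx; rewrite -(ltr_pM2l mu1) nuE [X in X < _]mulrC ltr_pM2l // => hx.
  rewrite -(ltr_pM2l mu1) nuE [X in X < _]mulrC ltr_pM2l //.
  exact: lt_le_trans hx (config_mono_iter mu0 mono T em mx my xy).
have f01 y : 0 <= f y <= 1 by rewrite /f; case: (mu y < nu y); rewrite ?lexx ?ler01.
have nu_sum : \sum_y nu y = 1.
  by rewrite (sum_dist_after_on _ (glauber_stochastic_on V0 mu0)).
rewrite dTV_upper_set ?nu_sum //.
have nuf : \sum_y nu y * f y <= iter T1 (block mu theta T2) f (ones V).
  (* The factor [mu (ones V)] turns evaluation at the start into a pairing with [e] under [mu], as
     in [blocks_le]. *)
  rewrite -(ler_pM2l mu1) mulr_sumr.
  have := blocks_le mu0 mu1 mono theta01 T1 T2 fm em.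
  under [X in _ <= X]eq_bigr => x _ do rewrite mulrC.
  rewrite sum_dirac; apply: le_trans; apply: ler_sum => y _.
  by rewrite mulrA nuE mulrAC.
have FDf : `|iter T1 (op (field_dynamics mu theta)) f (ones V) - \sum_y mu y * f y| <= eps / 2.
  rewrite -dist_after_op; apply: le_trans FD_mixed; apply: expectation_dTV => //.
  by rewrite mu_sum (sum_dist_after_on _ (field_dynamics_stochastic_on _ _ _)).
have err := iter_block_field_dynamics mu0 mu1 theta01 V0 tilted_mixed T1 mu1 f01.
have Td : T1%:R * delta <= eps / 2.
  (* For [T1 = 0] the product is 0 whatever value [delta] takes. *)
  rewrite /delta; case: (posnP T1) => [->|T10]; first by rewrite mul0r divr_ge0 // ltW.
  have T1n : T1%:R != 0 :> R by rewrite pnatr_eq0 -lt0n.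
  by rewrite invfM [_^-1 * _]mulrC mulrCA mulVKf.
move: err FDf; rewrite !ler_norml; lra.
Qed.
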